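(* Let $A$ be an atomic domain and $S$ the multiplicative set of $A$ generated by all nonprime atoms of $A$. (i) If $M$ is a PS module over $A$, then $M$ is a PS module over $A_S$ (that is, each $s\in S$ acts bijectively on $M$, so $M$ is an $A_S$-module, and it is PS as such). (ii) Conversely, if $N$ is a PS module over $A_S$, then $N$ is a PS module over $A$ (by restriction of scalars). Hence the PS modules over $A$ are exactly the PS modules over the fraction ring $A_S$ (which is a UFD).
   Context: All rings are commutative and unitary. An integral domain $A$ is atomic if every nonzero nonunit of $A$ is a finite product of irreducible elements (atoms). For an integral domain $A$, a torsion-free $A$-module $M$ is a PS module (pre-Schreier module) if every equality $ax=by$ with $a,b\in A-\{0\}$ and $x,y\in M-\{0\}$ has a refinement, i.e. there exist $c,d,e\in A$ and $z\in M$ with $a=ce$, $b=cd$, $x=dz$, $y=ez$. *)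

(* Defs.v *)
From HB Require Import structures.
From mathcomp Require Import all_boot all_algebra.
From mathcomp Require Import boolp classical_sets.

Set Implicit Arguments.
Unset Strict Implicit.
Unset Printing Implicit Defensive.

Import GRing.Theory.
Local Open Scope ring_scope.

Section Factorization.
Variable A : idomainType.
Implicit Types a b c p : A.

Definition divides a b : Prop := exists c, b = a * c.

Definition associated a b : Prop := exists2 u, u \is a GRing.unit & b = u * a.

Definition atom a : Prop :=
  [/\ a != 0, a \isn't a GRing.unit
    & forall b c, a = b * c -> b \is a GRing.unit \/ c \is a GRing.unit].

Definition prime_elt p : Prop :=
  [/\ p != 0, p \isn't a GRing.unit
    & forall a b, divides p (a * b) -> divides p a \/ divides p b].

Definition atomic : Prop :=
  forall a, a != 0 -> a \isn't a GRing.unit ->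
  exists2 s : seq A, (forall p, p \in s -> atom p) & a = \prod_(p <- s) p.

Definition unique_factorization_domain : Prop :=
  atomic /\
  forall s t : seq A,
    (forall p, p \in s -> atom p) -> (forall p, p \in t -> atom p) ->
    \prod_(p <- s) p = \prod_(p <- t) p ->
  exists t' : seq A,
    [/\ perm_eq t t', size s = size t'
      & forall i, (i < size s)%N -> associated s`_i t'`_i].

End Factorization.

Section PSModules.
Variables (A : idomainType) (M : lmodType A).

Definition torsion_free : Prop :=
  forall (a : A) (x : M), a *: x = 0 -> a = 0 \/ x = 0.

Definition PS_module : Prop :=
  torsion_free /\
  forall (a b : A) (x y : M), a != 0 -> b != 0 -> x != 0 -> y != 0 ->
    a *: x = b *: y ->
  exists (c d e : A) (z : M),
    [/\ a = c * e, b = c * d, x = d *: z & y = e *: z].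

End PSModules.
Arguments torsion_free {A} M.
Arguments PS_module {A} M.

(* 0 is excluded, so that fractions can be taken inside {fraction A}. *)
Record mulset (A : idomainType) := MulSet {
  in_mulset :> A -> Prop;
  mulset1 : in_mulset 1;
  mulsetM : forall s t, in_mulset s -> in_mulset t -> in_mulset (s * t);
  mulset_neq0 : forall s, in_mulset s -> s != 0 }.

Inductive mulgen (A : idomainType) (P : A -> Prop) : A -> Prop :=
| mulgen_one : mulgen P 1
| mulgen_base a of P a : mulgen P a
| mulgen_mul s t of mulgen P s & mulgen P t : mulgen P (s * t).

Definition nonprime_atom (A : idomainType) (a : A) : Prop :=
  atom a /\ ~ prime_elt a.

Lemma mulgen_nonprime_atom_neq0 (A : idomainType) (s : A) :
  mulgen (@nonprime_atom A) s -> s != 0.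
Proof.
elim=> [|a [[]]//|t u _ t0 _ u0]; first exact: oner_neq0.
by rewrite mulf_eq0 negb_or t0.
Qed.

Definition nonprime_atoms (A : idomainType) : mulset A :=
  MulSet (mulgen_one (@nonprime_atom A)) (@mulgen_mul A (@nonprime_atom A))
    (@mulgen_nonprime_atom_neq0 A).

Notation "x %:F" := (@FracField.tofrac _ x) : ring_scope.

Section Localization.
Variables (A : idomainType) (S : mulset A).

Definition is_loc : pred {fraction A} :=
  fun x => `[< exists a s : A, S s /\ x = a%:F / s%:F >].

Lemma is_locP x : reflect (exists a s : A, S s /\ x = a%:F / s%:F) (x \in is_loc).
Proof. exact: asboolP. Qed.

Lemma mulset_tofrac_neq0 s : S s -> s%:F != 0.
Proof. by move=> Ss; rewrite tofrac_eq0 (mulset_neq0 Ss). Qed.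

Lemma is_loc_subring_closed : subring_closed is_loc.
Proof.
split=> [|x y|x y].
- apply/is_locP; exists 1, 1; split; first exact: mulset1.
  by rewrite tofrac1 divr1.
- move=> /is_locP[a [s [Ss ->]]] /is_locP[b [t [St ->]]]; apply/is_locP.
  exists (a * t - b * s), (s * t); split; first exact: mulsetM.
  by rewrite -mulNr addf_div ?mulset_tofrac_neq0// mulNr tofracB !tofracM.
- move=> /is_locP[a [s [Ss ->]]] /is_locP[b [t [St ->]]]; apply/is_locP.
  exists (a * b), (s * t); split; first exact: mulsetM.
  by rewrite mulf_div !tofracM.
Qed.

(* The ring of fractions A_S, as a subring of the fraction field of A. *)
Record loc := Loc { loc_val : {fraction A}; loc_valP : loc_val \in is_loc }.

HB.instance Definition _ := [isSub for loc_val].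
HB.instance Definition _ := [Choice of loc by <:].
HB.instance Definition _ := GRing.SubChoice_isSubComNzRing.Build
  {fraction A} is_loc loc is_loc_subring_closed.

Definition loc_unit : pred loc := fun x => `[< exists y, y * x = 1 >].

Definition loc_inv (x : loc) : loc :=
  if x \in loc_unit then xget x [set y | y * x = 1] else x.

Lemma loc_mulVx : {in loc_unit, left_inverse 1 loc_inv *%R}.
Proof.
move=> x ux; rewrite /loc_inv ux.
by move/asboolP: ux => [y yx]; exact: (@xgetI _ x [set z | z * x = 1] y yx).
Qed.

Lemma loc_unitPl x y : y * x = 1 -> loc_unit x.
Proof. by move=> yx; apply/asboolP; exists y. Qed.

Lemma loc_invr_out : {in [predC loc_unit], loc_inv =1 id}.
Proof. by move=> x /negbTE nux; rewrite /loc_inv nux. Qed.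

HB.instance Definition _ := GRing.ComNzRing_hasMulInverse.Build loc
  loc_mulVx loc_unitPl loc_invr_out.

Lemma loc_integral : GRing.integral_domain_axiom loc.
Proof.
move=> x y /(congr1 val)/eqP; rewrite rmorphM rmorph0 mulf_eq0 /=.
by rewrite -!(inj_eq val_inj) rmorph0.
Qed.

HB.instance Definition _ := GRing.ComUnitRing_isIntegral.Build loc loc_integral.

Lemma to_loc_subproof (a : A) : a%:F \in is_loc.
Proof.
apply/is_locP; exists a, 1; split; first exact: mulset1.
by rewrite tofrac1 divr1.
Qed.

Definition to_loc (a : A) : loc := Loc (to_loc_subproof a).

Lemma to_loc_is_zmod_morphism : zmod_morphism to_loc.
Proof. by move=> a b; apply: val_inj; rewrite rmorphB /= tofracB. Qed.

Lemma to_loc_is_monoid_morphism : monoid_morphism to_loc.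
Proof.
by split=> [|a b]; apply: val_inj; rewrite ?rmorph1 ?rmorphM /= ?tofrac1 ?tofracM.
Qed.

HB.instance Definition _ := GRing.isZmodMorphism.Build A loc to_loc
  to_loc_is_zmod_morphism.
HB.instance Definition _ := GRing.isMonoidMorphism.Build A loc to_loc
  to_loc_is_monoid_morphism.

Lemma to_loc_inj : injective to_loc.
Proof. by move=> a b /(congr1 val)/eqP /=; rewrite tofrac_eq => /eqP. Qed.

Lemma to_loc_unit s : S s -> to_loc s \is a GRing.unit.
Proof.
move=> Ss; have Vs : s%:F^-1 \in is_loc.
  by apply/is_locP; exists 1, s; rewrite tofrac1 mul1r.
apply: (@loc_unitPl _ (Loc Vs)); apply: val_inj.
by rewrite rmorphM rmorph1 /= mulVf ?mulset_tofrac_neq0.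
Qed.

Lemma locP (q : loc) : exists a s, S s /\ to_loc s * q = to_loc a.
Proof.
have /is_locP[a [s [Ss qE]]] := loc_valP q.
exists a, s; split=> //; apply: val_inj.
by rewrite rmorphM /= qE mulrC divfK ?mulset_tofrac_neq0.
Qed.

End Localization.

Definition restrict_scalars (R R' : pzRingType) (f : {rmorphism R -> R'})
  (N : lmodType R') : Type := N.
Arguments restrict_scalars {R R'} f N.

Section RestrictionOfScalars.
Variables (R R' : pzRingType) (f : {rmorphism R -> R'}) (N : lmodType R').
Local Notation N_R := (restrict_scalars f N).

HB.instance Definition _ := GRing.Zmodule.on N_R.

Definition restrict_scale (a : R) (x : N_R) : N_R := f a *: (x : N).

Lemma restrict_scalerA a b x :
  restrict_scale a (restrict_scale b x) = restrict_scale (a * b) x.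
Proof. by rewrite /restrict_scale rmorphM scalerA. Qed.

Lemma restrict_scale1r : left_id 1 restrict_scale.
Proof. by move=> x; rewrite /restrict_scale rmorph1 scale1r. Qed.

Lemma restrict_scalerDr : right_distributive restrict_scale +%R.
Proof. by move=> a x y; exact: scalerDr. Qed.

Lemma restrict_scalerDl x : {morph restrict_scale^~ x : a b / a + b}.
Proof. by move=> a b; rewrite /restrict_scale rmorphD scalerDl. Qed.

HB.instance Definition _ := GRing.Zmodule_isLmodule.Build R N_R
  restrict_scalerA restrict_scale1r restrict_scalerDr restrict_scalerDl.

End RestrictionOfScalars.

Definition acts_bijectively (A : idomainType) (S : mulset A) (M : lmodType A) :
    Prop :=
  forall s : A, S s -> bijective (fun x : M => s *: x).

(* M itself, with the A_S-module structure in which (a / s) *: x is the unique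
   y such that s *: y = a *: x. *)
Definition extend_scalars (A : idomainType) (S : mulset A) (M : lmodType A)
  (bijM : acts_bijectively S M) : Type := M.

Section LocalizedScalars.
Variables (A : idomainType) (S : mulset A) (M : lmodType A).
Variable bijM : acts_bijectively S M.
Local Notation M_S := (extend_scalars bijM).

HB.instance Definition _ := GRing.Zmodule.on M_S.

Definition extend_scale (q : loc S) (x : M_S) : M_S :=
  xget (0 : M)
    [set y : M | exists a s : A,
      [/\ S s, to_loc S s * q = to_loc S a & s *: y = a *: (x : M)]].

Lemma extend_scale_eq (q : loc S) (x y : M) (a s : A) :
  S s -> to_loc S s * q = to_loc S a -> s *: y = a *: x ->
  extend_scale q x = y.
Proof.
move=> Ss sq sy; apply: xget_unique; first by exists a, s.
move=> y' [a' [s' [Ss' s'q s'y]]].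
have E : s * a' = s' * a.
  apply: (@to_loc_inj _ S); rewrite !rmorphM /= -sq -s'q; exact: mulrCA.
apply: (bij_inj (bijM (mulsetM Ss Ss'))).
by rewrite /= -!scalerA s'y scalerA E -scalerA -sy !scalerA mulrC.
Qed.

Lemma extend_scaleP (q : loc S) (x : M) : exists (y : M) (a s : A),
  [/\ S s, to_loc S s * q = to_loc S a, s *: y = a *: x & extend_scale q x = y].
Proof.
have [a [s [Ss sq]]] := locP q.
have [g _ gK] := bijM Ss.
have sy : s *: g (a *: x) = a *: x := gK _.
exists (g (a *: x)), a, s; split=> //.
exact: extend_scale_eq Ss sq sy.
Qed.

Lemma extend_scalerA p q x :
  extend_scale p (extend_scale q x) = extend_scale (p * q) x.
Proof.
have [y [a [s [Ss sq sy ->]]]] := extend_scaleP q x.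
have [z [b [t [St tp tz ->]]]] := extend_scaleP p y.
symmetry; apply: (@extend_scale_eq _ _ _ (b * a) (s * t)).
- exact: mulsetM.
- by rewrite !rmorphM /= [p * q]mulrC mulrACA sq tp mulrC.
- by rewrite -scalerA tz scalerA [s * b]mulrC -!scalerA sy.
Qed.

Lemma extend_scale1r : left_id 1 extend_scale.
Proof.
move=> x; apply: (@extend_scale_eq _ _ _ 1 1) => //; first exact: mulset1.
by rewrite mulr1.
Qed.

Lemma extend_scalerDr : right_distributive extend_scale +%R.
Proof.
move=> q x y.
have [x' [a [s [Ss sq sx ->]]]] := extend_scaleP q x.
have [y' [b [t [St tq ty ->]]]] := extend_scaleP q y.
apply: (@extend_scale_eq _ _ (x' + y' : M) (t * a) (t * s)).
- exact: mulsetM.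
- by rewrite !rmorphM /= -mulrA sq.
- have E : t * a = s * b.
    by apply: (@to_loc_inj _ S); rewrite !rmorphM /= -sq -tq mulrCA.
  have tsx : (t * s) *: x' = (t * a) *: (x : M) by rewrite -!scalerA sx.
  have tsy : (t * s) *: y' = (t * a) *: (y : M) by rewrite E mulrC -!scalerA ty.
  by rewrite scalerDr tsx tsy -scalerDr.
Qed.

Lemma extend_scalerDl x : {morph extend_scale^~ x : p q / p + q}.
Proof.
move=> p q /=.
have [y [a [s [Ss sp sy ->]]]] := extend_scaleP p x.
have [z [b [t [St tq tz ->]]]] := extend_scaleP q x.
apply: (@extend_scale_eq _ _ (y + z : M) (t * a + s * b) (t * s)).
- exact: mulsetM.
- rewrite rmorphD !rmorphM /= -sp -tq mulrDr -mulrA; congr (_ + _).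
  by rewrite mulrAC mulrC.
- have tsy : (t * s) *: y = (t * a) *: (x : M) by rewrite -!scalerA sy.
  have tsz : (t * s) *: z = (s * b) *: (x : M) by rewrite mulrC -!scalerA tz.
  by rewrite scalerDr tsy tsz -scalerDl.
Qed.

HB.instance Definition _ := GRing.Zmodule_isLmodule.Build (loc S) M_S
  extend_scalerA extend_scale1r extend_scalerDr extend_scalerDl.

End LocalizedScalars.

(* extend_scalars and restrict_scalars are mutually inverse: both keep the
   underlying group and the two scalings agree. *)
Lemma restrict_extend_scalars (A : idomainType) (S : mulset A) (M : lmodType A)
    (bijM : acts_bijectively S M) (a : A) (x : M) :
  a *: (x : restrict_scalars (to_loc S) (extend_scalars bijM)) = a *: x.
Proof.
apply: (@extend_scale_eq _ _ _ bijM _ x _ a 1) => //; first exact: mulset1.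
  by rewrite rmorph1 mul1r.
by rewrite scale1r.
Qed.

Lemma restrict_acts_bijectively (A : idomainType) (S : mulset A)
    (N : lmodType (loc S)) :
  acts_bijectively S (restrict_scalars (to_loc S) N).
Proof.
move=> s Ss; have us := to_loc_unit Ss.
exists (fun x : N => (to_loc S s)^-1 *: x) => x.
  by rewrite [LHS]scalerA mulVr// scale1r.
by rewrite [LHS]scalerA divrr// scale1r.
Qed.

Lemma extend_restrict_scalars (A : idomainType) (S : mulset A)
    (N : lmodType (loc S))
    (bijN : acts_bijectively S (restrict_scalars (to_loc S) N))
    (q : loc S) (x : N) :
  q *: (x : extend_scalars bijN) = q *: x.
Proof.
have [a [s [Ss sq]]] := locP q.
apply: (extend_scale_eq bijN Ss sq).
by rewrite [LHS]scalerA sq.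
Qed.

(* Main.v *)
Require Import Defs.
From mathcomp Require Import all_boot all_algebra.
From mathcomp Require Import boolp.

(** In an atomic domain A every nonzero element is a unit times an element of S
    times a product of primes, and the primes of A stay prime in A_S; hence A_S
    is a UFD.

    (i) Let s be a nonprime atom, say s | ab with s dividing neither a nor b.
    Refining s (c x) = a (b x) and then b x = s z' shows x in s M, so s acts
    bijectively on a PS module; refinements over A_S follow by clearing
    denominators.

    (ii) A relation a x = b y over A is refined by induction on the number of
    primes in a.  If a prime p of a divides b, it is cancelled; otherwise the
    refinement over A_S of p (a' x) = b y shows that p divides y.  When no prime
    is left, a acts bijectively and x = b z, y = a z with z = y / a. *)

Set Implicit Arguments.
Unset Strict Implicit.
Unset Printing Implicit Defensive.

Import GRing.Theory.
Local Open Scope ring_scope.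

(** * Primes, atoms and unique factorization in a domain *)

Section Divisibility.
Variable R : idomainType.
Implicit Types (a b p q u : R) (s t : seq R).

Lemma unitr_neq0 u : u \is a GRing.unit -> u != 0.
Proof. by apply: contraTneq => ->; rewrite unitr0. Qed.

Lemma divides_mulr a b c : divides a b -> divides a (b * c).
Proof. by case=> d ->; exists (d * c); rewrite mulrA. Qed.

Lemma divides_mull a b c : divides a b -> divides a (c * b).
Proof. by rewrite mulrC; exact: divides_mulr. Qed.

Lemma prime_not_divides_unit p u :
  prime_elt p -> u \is a GRing.unit -> ~ divides p u.
Proof.
by case=> _ np _ uu [c ucE]; move: uu; rewrite ucE unitrM (negPf np).
Qed.

Lemma prime_elt_atom p : prime_elt p -> atom p.
Proof.
case=> p0 np pP; split=> // b c pE.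
have [[k kE]|[k kE]] : divides p b \/ divides p c.
    by apply: pP; exists 1; rewrite mulr1.
- right; apply/unitrPr; exists k; apply: (mulfI p0).
  by rewrite mulr1 {2}pE kE -mulrA [c * k]mulrC.
- left; apply/unitrPr; exists k; apply: (mulfI p0).
  by rewrite mulr1 {2}pE kE mulrCA.
Qed.

Lemma prime_eltMl u p : u \is a GRing.unit -> prime_elt p -> prime_elt (u * p).
Proof.
move=> uu [p0 np pP]; split.
- by rewrite mulf_neq0// (unitr_neq0 uu).
- by rewrite unitrMr.
have up a : divides p a -> divides (u * p) a.
  by case=> c ->; exists (u^-1 * c); rewrite mulrACA divrr// mul1r.
move=> a b [c abE]; have [|/up|/up] := pP a b; [|by left|by right].
by exists (u * c); rewrite abE mulrCA mulrA.
Qed.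

Lemma prime_divides_prod p s : prime_elt p -> divides p (\prod_(q <- s) q) ->
  exists2 q, q \in s & divides p q.
Proof.
move=> pp; have [_ _ pP] := pp; elim: s => [|q s IHs].
  by rewrite big_nil => /(prime_not_divides_unit pp (unitr1 _)).
rewrite big_cons => /pP[pq|/IHs[r rs pr]].
  by exists q; rewrite ?mem_head.
by exists r; rewrite ?inE ?rs ?orbT.
Qed.

Lemma prime_divides_atom p q : prime_elt p -> atom q -> divides p q ->
  associated p q.
Proof.
case=> _ np _ [_ _ qP] [c qE]; have [up|uc] := qP _ _ qE.
  by rewrite up in np.
by exists c => //; rewrite mulrC.
Qed.

(** The unit [u] is there for the induction on [s]: cancelling the head [p] against an associate
    [q = v * p] in [t] leaves the factor [v], which joins [u]. *)
Lemma prime_factorization_unique s t u : u \is a GRing.unit ->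
    (forall p, p \in s -> prime_elt p) -> (forall p, p \in t -> prime_elt p) ->
    \prod_(p <- s) p = u * \prod_(p <- t) p ->
  exists t', [/\ perm_eq t t', size s = size t'
    & forall i, (i < size s)%N -> associated s`_i t'`_i].
Proof.
elim: s t u => [|p s IHs] t u uu sP tP.
  rewrite big_nil => E; exists [::]; split=> //.
  case: t tP E => // q t tP; rewrite big_cons => E.
  have qq : prime_elt q by apply: tP; rewrite mem_head.
  have := prime_not_divides_unit qq (unitr1 _); case.
  by rewrite E; apply: divides_mull; exists (\prod_(j <- t) j).
rewrite big_cons => E.
have pp : prime_elt p by apply: sP; rewrite mem_head.
have [q qt pq] : exists2 q, q \in t & divides p q.
  apply: prime_divides_prod => //; exists (u^-1 * \prod_(j <- s) j).
  by rewrite mulrCA E mulKr.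
have [v uv qE] := prime_divides_atom pp (prime_elt_atom (tP _ qt)) pq.
have [t' [tt' st' aP]] : exists t', [/\ perm_eq (rem q t) t', size s = size t'
    & forall i, (i < size s)%N -> associated s`_i t'`_i].
  apply: (IHs _ (u * v)); first by rewrite unitrMr.
  - by move=> r rs; apply: sP; rewrite inE rs orbT.
  - by move=> r /mem_rem; exact: tP.
  - have [p0 _ _] := pp; apply: (mulfI p0).
    rewrite E (perm_big _ (perm_to_rem qt)) big_cons /= qE.
    by rewrite -!mulrA [RHS]mulrCA; congr (_ * _); rewrite mulrCA.
exists (q :: t'); split=> /=; last by case=> [_|i /aP//]; exists v.
- by apply: (perm_trans (perm_to_rem qt)); rewrite perm_cons.
- by rewrite st'.
Qed.

(** Under this hypothesis atoms are prime: an atom has at least one prime in its factorization, and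
    irreducibility forces the remaining factor to be a unit. Uniqueness then only concerns products
    of primes. *)
Lemma UFD_prime_factorization :
    (forall a, a != 0 -> exists u s, [/\ u \is a GRing.unit,
       forall p, p \in s -> prime_elt p & a = u * \prod_(p <- s) p]) ->
  unique_factorization_domain R.
Proof.
move=> H.
have atom_prime a : atom a -> prime_elt a.
  case=> a0 na aP; have [u [[|p s] [uu sP aE]]] := H a a0.
    by rewrite aE big_nil mulr1 uu in na.
  have pp : prime_elt p by apply: sP; rewrite mem_head.
  have upp := prime_eltMl uu pp.
  rewrite big_cons mulrA in aE; have [uup|us] := aP _ _ aE.
    by case: upp => _; rewrite uup.
  by rewrite aE mulrC; apply: prime_eltMl.
split=> [a a0 na|s t sP tP E].
  have [u [[|p s] [uu sP aE]]] := H a a0.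
    by rewrite aE big_nil mulr1 uu in na.
  (* A product of atoms leaves no room for a separate unit, so [u] is absorbed into the first
     prime. *)
  exists (u * p :: s); last by rewrite aE !big_cons mulrA.
  move=> q; rewrite inE => /predU1P[->|qs]; apply: prime_elt_atom.
    by apply: prime_eltMl => //; apply: sP; rewrite mem_head.
  by apply: sP; rewrite inE qs orbT.
apply: (@prime_factorization_unique s t 1); rewrite ?unitr1 ?mul1r//.
- by move=> p /sP/atom_prime.
- by move=> p /tP/atom_prime.
Qed.

End Divisibility.

(** * Primes of A in a ring of fractions *)

Section LocalizedPrimes.
Variables (A : idomainType) (S : mulset A).

Lemma to_loc_eq0 (a : A) : (to_loc S a == 0) = (a == 0).
Proof. by rewrite -(inj_eq (@to_loc_inj _ S)) rmorph0. Qed.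

Lemma to_loc_unitM (u s : A) :
  u \is a GRing.unit -> S s -> to_loc S (u * s) \is a GRing.unit.
Proof.
move=> uu Ss; rewrite rmorphM unitrM /= (to_loc_unit Ss) andbT.
exact: (rmorph_unit (to_loc S)).
Qed.

Variables (p : A) (pp : prime_elt p) (pS : forall s, S s -> ~ divides p s).

(** Clearing the denominator [s] of the quotient makes [p] divide [s * a], and [pS] excludes that it
    divides [s]. *)
Lemma divides_to_loc (a : A) :
  divides (to_loc S p) (to_loc S a) -> divides p a.
Proof.
case=> q aE; have [b [s [Ss sq]]] := locP q.
have [_ _ pP] := pp; have [/pS[]//|//] : divides p s \/ divides p a.
apply: pP; exists b; apply: (@to_loc_inj _ S).
by rewrite !rmorphM /= aE mulrCA sq.
Qed.

Lemma prime_elt_to_loc : prime_elt (to_loc S p).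
Proof.
have [p0 np pP] := pp; split; first by rewrite to_loc_eq0.
  apply/negP => /unitrPr[q pq]; apply: (prime_not_divides_unit pp (unitr1 _)).
  by apply: divides_to_loc; exists q; rewrite pq rmorph1.
(* Since [s] becomes a unit, divisibility of a fraction by [p] follows from that of its
   numerator. *)
have divl s a q : S s -> to_loc S s * q = to_loc S a -> divides p a ->
    divides (to_loc S p) q.
  move=> Ss sq [c aE]; exists ((to_loc S s)^-1 * to_loc S c).
  by rewrite mulrCA -rmorphM /= -aE -sq mulKr// to_loc_unit.
move=> q r pqr; have [a [s [Ss sq]]] := locP q; have [b [t [St tr]]] := locP r.
have /pP[pa|pb] : divides p (a * b).
- apply: divides_to_loc; rewrite rmorphM /= -sq -tr mulrACA.
  exact: divides_mull.
- by left; exact: divl sq pa.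
- by right; exact: divl tr pb.
Qed.

End LocalizedPrimes.

(** * Factorization in an atomic domain and in A_S *)

Section NonprimeAtoms.
Variables (A : idomainType) (hA : atomic A).
Local Notation S := (nonprime_atoms A).

(** A prime dividing an atom is associated to it, which would make the atom prime. *)
Lemma prime_not_divides_nonprime_atoms (p s : A) :
  prime_elt p -> S s -> ~ divides p s.
Proof.
move=> pp; elim=> [|a [aa npa]|t u _ IHt _ IHu].
- exact/prime_not_divides_unit/unitr1.
- move/(prime_divides_atom pp aa) => [u uu aE]; apply: npa.
  by rewrite aE; apply: prime_eltMl.
- by have [_ _ pP] := pp; case/pP.
Qed.

Lemma atomic_factorization (a : A) : a != 0 -> exists u s t,
  [/\ u \is a GRing.unit, S s, forall p, p \in t -> prime_elt p
    & a = u * s * \prod_(p <- t) p].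
Proof.
move=> a0; have [ua|/(hA a0)[r rP ->]] := boolP (a \is a GRing.unit).
  exists a, 1, [::]; split=> //; first exact: mulset1.
  by rewrite big_nil !mulr1.
suff [s [t [Ss tP E]]] : exists s t, [/\ S s,
    forall p, p \in t -> prime_elt p & \prod_(p <- r) p = s * \prod_(p <- t) p].
  by exists 1, s, t; rewrite unitr1 mul1r.
elim: r rP {a a0} => [|a r IHr] rP.
  by exists 1, [::]; rewrite !big_nil mulr1; split=> //; exact: mulset1.
have [|s [t [Ss tP rE]]] := IHr.
  by move=> p pr; apply: rP; rewrite inE pr orbT.
rewrite big_cons rE; have [pa|npa] := pselect (prime_elt a).
  exists s, (a :: t); split=> //; last by rewrite big_cons mulrCA.
  by move=> p; rewrite inE => /predU1P[->|/tP].
exists (a * s), t; split=> //; last by rewrite mulrA.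
apply: mulsetM => //; apply: mulgen_base; split=> //.
by apply: rP; rewrite mem_head.
Qed.

Lemma prime_elt_to_loc_nonprime_atoms (p : A) :
  prime_elt p -> prime_elt (to_loc S p).
Proof.
move=> pp; apply: prime_elt_to_loc => // s.
exact: prime_not_divides_nonprime_atoms.
Qed.

Lemma loc_nonprime_atoms_UFD : unique_factorization_domain (loc S).
Proof.
apply: UFD_prime_factorization => q q0; have [a [s [Ss sq]]] := locP q.
have us := to_loc_unit Ss.
have a0 : a != 0 by rewrite -(to_loc_eq0 S) -sq mulf_neq0// unitr_neq0.
have [u [r [t [uu Sr tP aE]]]] := atomic_factorization a0.
exists ((to_loc S s)^-1 * to_loc S (u * r)), [seq to_loc S p | p <- t]; split.
- by rewrite unitrM unitrV us to_loc_unitM.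
- by move=> _ /mapP[p /tP pp ->]; exact: prime_elt_to_loc_nonprime_atoms.
- by rewrite big_map -(rmorph_prod (to_loc S)) -mulrA -rmorphM /= -aE -sq mulKr.
Qed.

End NonprimeAtoms.

(** * PS modules over A and extension of scalars *)

Section PSModuleTheory.
Variable A : idomainType.

Lemma torsion_free_scaler_eq0 (M : lmodType A) : torsion_free M ->
  forall (a : A) (x : M), (a *: x == 0) = (a == 0) || (x == 0).
Proof.
move=> tfM a x; apply/eqP/orP => [/tfM[->|->]|[]/eqP->]; rewrite ?eqxx; auto.
- by rewrite scale0r.
- by rewrite scaler0.
Qed.

Lemma torsion_free_scalerI (M : lmodType A) (a : A) : torsion_free M ->
  a != 0 -> injective (fun x : M => a *: x).
Proof.
move=> tfM a0 x y /eqP; rewrite -subr_eq0 -scalerBr torsion_free_scaler_eq0//.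
by rewrite (negPf a0) subr_eq0 => /eqP.
Qed.

(** Meant for [f] the identity, between two module structures on one group whose scalings are
    provably equal but not convertible. *)
Lemma PS_module_transfer (M M' : lmodType A) (f : M -> M') :
    bijective f -> (forall a x, f (a *: x) = a *: f x) ->
  PS_module M -> PS_module M'.
Proof.
move=> bf fZ [tfM rfM]; have [g fK gK] := bf.
have f0 : f 0 = 0 by rewrite -[0](scale0r (0 : M)) fZ scale0r.
have gZ a x : g (a *: x) = a *: g x by rewrite -{1}(gK x) -fZ fK.
have g0 : g 0 = 0 by rewrite -f0 fK.
have gn0 x : x != 0 -> g x != 0 by apply: contra_neq => E; rewrite -(gK x) E.
split=> [a x /(congr1 g)|a b x y a0 b0 x0 y0 /(congr1 g)].
  rewrite gZ g0 => /tfM[|E]; [by left|right].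
  by rewrite -(gK x) E.
rewrite !gZ => /(rfM _ _ _ _ a0 b0 (gn0 _ x0) (gn0 _ y0)).
case=> [c [d [e [z [aE bE xE yE]]]]].
by exists c, d, e, (f z); rewrite -!fZ -xE -yE !gK.
Qed.

Lemma PS_module_nonprime_atom_surj (M : lmodType A) (s : A) :
  PS_module M -> nonprime_atom s -> forall x : M, exists y, x = s *: y.
Proof.
move=> [tfM rfM] [[s0 ns sP] nps] x.
have [->|x0] := eqVneq x 0; first by exists 0; rewrite scaler0.
have [a [b [[c abE] nsa nsb]]] : exists a b,
    [/\ divides s (a * b), ~ divides s a & ~ divides s b].
  apply: contra_notP nps => H; split=> // a b sab.
  apply: contrapT => /not_orP[nsa nsb]; apply: H; by exists a, b.
have nd0 d : ~ divides s d -> d != 0.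
  by apply: contra_not_neq => ->; exists 0; rewrite mulr0.
have [a0 b0] := (nd0 _ nsa, nd0 _ nsb).
have c0 : c != 0.
  by apply: contra_neq (mulf_neq0 a0 b0) => c0; rewrite abE c0 mulr0.
(* The refinement writes [s = f * e], [d = f * g] and [y = e *: z]. As [s] is an atom, either [f] is
   a unit and [y] lies in s M, or [e] is a unit and [s] divides [d]. *)
have cancel d (y y' : M) : ~ divides s d -> y != 0 -> y' != 0 ->
    s *: y' = d *: y -> exists z, y = s *: z.
  move=> nsd y0 y'0 E.
  have [f [g [e [z [sE dE _ yE]]]]] := rfM _ _ _ _ s0 (nd0 _ nsd) y'0 y0 E.
  have [uf|ue] := sP _ _ sE.
    by exists (f^-1 *: z); rewrite yE scalerA sE mulrAC divrr// mul1r.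
  case: nsd; exists (e^-1 * g).
  by rewrite sE dE -mulrA [e * _]mulrA divrr// mul1r.
have bx0 : b *: x != 0 by rewrite torsion_free_scaler_eq0// negb_or b0.
have [z zE] : exists z, b *: x = s *: z.
  apply: (cancel a _ (c *: x)) => //; last by rewrite !scalerA abE.
  by rewrite torsion_free_scaler_eq0// negb_or c0.
apply: (cancel b _ z) => //.
by apply: contra_neq bx0 => z0; rewrite zE z0 scaler0.
Qed.

Lemma PS_module_acts_bijectively (M : lmodType A) :
  PS_module M -> acts_bijectively (nonprime_atoms A) M.
Proof.
move=> psM s Ss; have [tfM _] := psM.
have sP : forall x : M, exists y, x = s *: y.
  elim: Ss => [x|a na|t u _ IHt _ IHu x].
  - by exists x; rewrite scale1r.
  - exact: PS_module_nonprime_atom_surj.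
  - have [y ->] := IHt x; have [z ->] := IHu y.
    by exists z; rewrite scalerA.
have /choice[g gP] := sP; exists g => x //.
by apply: (torsion_free_scalerI tfM (mulset_neq0 Ss)); rewrite /= -gP.
Qed.

Lemma PS_module_extend_scalars (S : mulset A) (M : lmodType A)
    (bijM : acts_bijectively S M) :
  PS_module M -> PS_module (extend_scalars bijM).
Proof.
move=> [tfM rfM].
have scaleE (q : loc S) (a s : A) (x : extend_scalars bijM) :
    S s -> to_loc S s * q = to_loc S a -> s *: (q *: x : M) = a *: (x : M).
  move=> Ss sq; rewrite -!(restrict_extend_scalars bijM).
  by rewrite [LHS](scalerA (to_loc S s) q x) sq.
have num0 (q : loc S) (a s : A) : to_loc S s * q = to_loc S a -> S s ->
    (a == 0) = (q == 0).
  move=> E /mulset_neq0/negPf s0.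
  by rewrite -(to_loc_eq0 S) -E mulf_eq0 to_loc_eq0 s0.
split=> [q x qx0|q r x y q0 r0 x0 y0 qxry].
  have [a [s [Ss sq]]] := locP q; have := scaleE _ _ _ x Ss sq.
  rewrite qx0 scaler0 => /esym/tfM[/eqP|]; last by right.
  by rewrite (num0 _ _ _ sq Ss) => /eqP; left.
have [a [s [Ss sq]]] := locP q; have [b [t [St tr]]] := locP r.
have ta0 : t * a != 0.
  by rewrite mulf_neq0 ?(mulset_neq0 St) ?(num0 _ _ _ sq Ss).
have sb0 : s * b != 0.
  by rewrite mulf_neq0 ?(mulset_neq0 Ss) ?(num0 _ _ _ tr St).
have E : (t * a) *: (x : M) = (s * b) *: (y : M).
  rewrite -!scalerA -(scaleE _ _ _ x Ss sq) -(scaleE _ _ _ y St tr) qxry.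
  by rewrite !scalerA mulrC.
have [c [d [e [z [aE bE xE yE]]]]] := rfM _ _ _ _ ta0 sb0 x0 y0 E.
have qE : to_loc S (s * t) * q = to_loc S (t * a).
  by rewrite !rmorphM /= -sq mulrA [to_loc S t * _]mulrC.
have rE : to_loc S (s * t) * r = to_loc S (s * b).
  by rewrite !rmorphM /= -tr mulrA.
have ust := to_loc_unit (mulsetM Ss St).
(* The fractions [q] and [r] have numerators [t * a] and [s * b] over the common denominator
   [s * t]. Only the common factor [c] takes this denominator, so the equations for [x] and [y] stay
   those over A. *)
exists ((to_loc S (s * t))^-1 * to_loc S c), (to_loc S d), (to_loc S e), z.
split.
- by rewrite -mulrA -rmorphM /= -aE -qE mulKr.
- by rewrite -mulrA -rmorphM /= -bE -rE mulKr.
- by rewrite xE -(restrict_extend_scalars bijM).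
- by rewrite yE -(restrict_extend_scalars bijM).
Qed.

End PSModuleTheory.

(** * Restriction of scalars from A_S to A *)

Lemma PS_module_restrict_scalars (A : idomainType) (hA : atomic A)
    (N : lmodType (loc (nonprime_atoms A))) :
  PS_module N -> PS_module (restrict_scalars (to_loc (nonprime_atoms A)) N).
Proof.
set S := nonprime_atoms A => psN; have [tfN rfN] := psN.
set N_A := restrict_scalars (to_loc S) N.
have scaleE (a : A) (x : N_A) : a *: x = to_loc S a *: (x : N) by [].
have tfN_A : torsion_free N_A.
  move=> a x /tfN[/eqP|]; last by right.
  by rewrite to_loc_eq0 => /eqP; left.
split=> // a b x y a0 b0 x0 y0.
have [u [s [t [uu Ss tP aE]]]] := atomic_factorization hA a0.
rewrite {a a0}aE.
have us : to_loc S (u * s) \is a GRing.unit by exact: to_loc_unitM.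
(* Both [b] and [y] must vary: removing [p] from the left side divides either [b] or [y] by [p]. *)
elim: t tP b b0 y y0 => [|p t IHt] tP b b0 y y0.
  rewrite big_nil mulr1 => E.
  exists 1, b, (u * s), ((to_loc S (u * s))^-1 *: (y : N)).
  rewrite !mul1r; split=> //.
    rewrite scaleE scalerA mulrC -scalerA -scaleE -E scaleE scalerA.
    by rewrite mulVr// scale1r.
  by rewrite scaleE scalerA divrr// scale1r.
rewrite big_cons mulrCA.
have tP' q : q \in t -> prime_elt q.
  by move=> qt; apply: tP; rewrite inE qt orbT.
have {tP}pp : prime_elt p by apply: tP; rewrite mem_head.
have [p0 np pP] := pp.
set a' := u * s * _ in IHt *.
have a'0 : a' != 0.
  apply: mulf_neq0; last first.
    by rewrite prodf_seq_neq0; apply/allP => q /tP'[].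
  by rewrite -(to_loc_eq0 S) unitr_neq0.
have [[b1 bE]|npb] := pselect (divides p b).
  rewrite bE -(scalerA p a') -(scalerA p b1).
  move=> /(torsion_free_scalerI tfN_A p0) E.
  have b10 : b1 != 0 by apply: contra_neq b0 => b10; rewrite bE b10 mulr0.
  have [c [d [e [z [a'E b1E xE yE]]]]] := IHt tP' _ b10 _ y0 E.
  (* Here [p] divides both coefficients, so it returns in their common factor. *)
  by exists (p * c), d, e, z; rewrite a'E b1E -!mulrA.
rewrite -(scalerA p a') => E.
have pS : forall r, S r -> ~ divides p r.
  by move=> r; exact: prime_not_divides_nonprime_atoms.
have [z yE] : exists z : N_A, y = p *: z.
  have a'x0 : a' *: x != 0 by rewrite torsion_free_scaler_eq0// negb_or a'0.
  have lp0 : to_loc S p != 0 by rewrite to_loc_eq0.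
  have lb0 : to_loc S b != 0 by rewrite to_loc_eq0.
  have [c [d [e [z [pE bE _ yE]]]]] := rfN _ _ _ _ lp0 lb0 a'x0 y0 E.
  (* In A_S, [p] is still an atom, equal to [c * e]. If [c] is a unit, [y = e *: z] is a multiple of
     [p]; if [e] is a unit, [p] divides [b] in A_S, hence in A. *)
  have [_ _ /(_ _ _ pE)[uc|ue]] :=
    prime_elt_atom (prime_elt_to_loc_nonprime_atoms pp).
    exists (c^-1 *: z : N).
    by rewrite yE [RHS](scalerA (to_loc S p) c^-1 z) pE mulrAC divrr// mul1r.
  case: npb; apply: (divides_to_loc pp pS); exists (e^-1 * d).
  by rewrite pE bE -mulrA [e * _]mulrA divrr// mul1r.
have z0 : z != 0 by apply: contra_neq y0 => z0; rewrite yE z0 scaler0.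
have {}E : a' *: x = b *: z.
  apply: (torsion_free_scalerI tfN_A p0).
  by rewrite /= E yE !scalerA mulrC.
have [c [d [e [w [a'E bE xE zE]]]]] := IHt tP' _ b0 _ z0 E.
(* Here [p] returns in the factor shared by the left coefficient and [y]. *)
exists c, d, (p * e), w; split=> //; first by rewrite a'E mulrCA.
by rewrite yE zE scalerA.
Qed.

Theorem theorem3p3 (A : idomainType) (hA : atomic A) :
  let S := nonprime_atoms A in
  [/\ (forall M : lmodType A, PS_module M ->
         exists bijM : acts_bijectively S M, PS_module (extend_scalars bijM)),
      (forall N : lmodType (loc S), PS_module N ->
         PS_module (restrict_scalars (to_loc S) N)),
      (forall M : lmodType A, PS_module M <->
         exists bijM : acts_bijectively S M, PS_module (extend_scalars bijM))
      /\ (forall N : lmodType (loc S), PS_module N <->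
            PS_module (restrict_scalars (to_loc S) N))
    & unique_factorization_domain (loc S)].
Proof.
move=> S.
have extP (M : lmodType A) : PS_module M ->
    exists bijM : acts_bijectively S M, PS_module (extend_scalars bijM).
  move=> psM; exists (PS_module_acts_bijectively psM).
  exact: PS_module_extend_scalars.
have resP := PS_module_restrict_scalars hA.
split=> //; last exact: loc_nonprime_atoms_UFD.
(* Each converse is the other direct implication followed by a round trip: extending and then
   restricting gives back [M], restricting and then extending gives back [N]. *)
split=> [M|N]; split; [exact: extP| |exact: resP|].
- case=> bijM /resP.
  pose M' := restrict_scalars (to_loc S) (extend_scalars bijM).
  apply: (@PS_module_transfer _ M' M id); first by exists id.
  by move=> a x; exact: restrict_extend_scalars.
- move=> /extP[bijN].
  apply: (@PS_module_transfer _ (extend_scalars bijN) N id); first by exists id.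
  by move=> q x; exact: extend_restrict_scalars.
Qed.
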